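(* Let $R$ be a unitary ring and let $d\in R$ be regular. Then the following statements are equivalent. (i) $d$ is group invertible. (ii) There exists $a\in R$ invertible along $d$ such that $aa^{\parallel d}=a^{\parallel d}a$.
   Context: $R$ is an associative ring with unit $1$. An element $d$ is regular if there is $z\in R$ with $d=dzd$. An element $a$ is invertible along $d$ if there is $b\in R$ with $b=bab$, $bR=dR$ and $Rb=Rd$; such $b$ is unique and is denoted $a^{\parallel d}$. An element $d\in R$ is group invertible if there is $d^\sharp\in R$ with $dd^\sharp d=d$, $d^\sharp dd^\sharp=d^\sharp$, $dd^\sharp=d^\sharp d$. *)

(* Defs.v *)
From mathcomp Require Import all_boot all_algebra.

Set Implicit Arguments.
Unset Strict Implicit.
Unset Printing Implicit Defensive.

Import GRing.Theory.
Local Open Scope ring_scope.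

Section InverseAlong.

Variable R : pzRingType.
Implicit Types a b c d x z : R.

Definition regular_elt d : Prop := exists z, d = d * z * d.

Definition right_ideal b : R -> Prop := fun x => exists r, x = b * r.
Definition left_ideal b : R -> Prop := fun x => exists r, x = r * b.

(* b is an inverse of a along d, i.e. b = a^{||d}; the relational form is
   justified by inverse_along_uniq. *)
Definition inverse_along d a b : Prop :=
  [/\ b = b * a * b,
      forall x, right_ideal b x <-> right_ideal d x
    & forall x, left_ideal b x <-> left_ideal d x].

Definition group_invertible d : Prop :=
  exists ds, [/\ d * ds * d = d, ds * d * ds = ds & d * ds = ds * d].

Lemma inverse_along_uniq d a b c :
  inverse_along d a b -> inverse_along d a c -> b = c.
Proof.
move=> [bab bR Rb] [cac cR Rc].
have [x bE] : right_ideal c b by apply/cR/bR; exists 1; rewrite mulr1.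
have [y cE] : left_ideal b c by apply/Rb/Rc; exists 1; rewrite mul1r.
have <- : c * a * b = b by rewrite {1}bE mulrA -cac -bE.
by rewrite {1}cE -!mulrA (mulrA b) -bab -cE.
Qed.

End InverseAlong.

(* Main.v *)
Require Import Defs.
From mathcomp Require Import all_boot all_algebra.

Import GRing.Theory.
Local Open Scope ring_scope.

(** If [d] has a group inverse [ds], then [d] is itself the inverse of [ds]
    along [d], and the two commute.

    Conversely, suppose that [b] is the inverse of [a] along [d] and that
    [a * b = b * a].  Then multiplication by [a * b], on either side, fixes [b]; so it
    fixes [b R] from the left and [R b] from the right, and [d] is in both.
    As [b] lies in [d R] and in [R d], the element [a * b] is both a left and
    a right multiple of [d].  Hence [d] lies in [d ^+ 2 R] and in [R d ^+ 2],
    which by [group_invertible_sqr] is enough for group invertibility. *)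

(** The two factorizations give [y * d = y * d * d * x = d * x], an idempotent
    fixing [d] on both sides.  Relative to this idempotent as unit, [x] is a right
    inverse and [y] a left inverse of [d], and [y * d * x] is a two-sided one. *)
Lemma group_invertible_sqr (R : pzRingType) (d x y : R) :
  d = d * d * x -> d = y * d * d -> group_invertible d.
Proof.
move=> dx dy.
have ydE : y * d = d * x by rewrite {1}dx !mulrA -dy.
have ds : d * (y * d * x) = d * x by rewrite ydE !mulrA -dx.
have sd : y * d * x * d = d * x.
  by rewrite -(mulrA y) -ydE -mulrA -dy.
exists (y * d * x); split; last by rewrite ds sd.
- by rewrite ds -ydE -dy.
- by rewrite sd ydE !mulrA -ydE -dy ydE.
Qed.

Theorem corollary6p2 (R : pzRingType) (d : R) (hd : regular_elt d) :
  group_invertible d <->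
  exists a : R, exists b : R, inverse_along d a b /\ a * b = b * a.
Proof.
split=> [[ds [dsd _ dsC]] | [a [b [[bab bR Rb] abC]]]].
  by exists ds, d; split; first split.
have [u bu] : right_ideal d b by apply/bR; exists 1; rewrite mulr1.
have [v bv] : left_ideal d b by apply/Rb; exists 1; rewrite mul1r.
have [x dx] : right_ideal b d by apply/bR; exists 1; rewrite mulr1.
have [y dy] : left_ideal b d by apply/Rb; exists 1; rewrite mul1r.
have d_ab : d * (b * a) = d by rewrite {1}dy -abC -mulrA (mulrA b) -bab -dy.
have ab_d : a * b * d = d by rewrite abC {1}dx mulrA -bab -dx.
apply: (@group_invertible_sqr _ d (u * a) (a * v)).
- by rewrite -mulrA (mulrA d u) -bu d_ab.
- by rewrite -(mulrA a) -bv ab_d.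
Qed.
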